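(* Let $i\in\mathbb{N}_0$ and let $\alpha,\gamma\in\mathbb{C}$. Then $$F^{2:0;1}_{1:0;1}\left[\begin{matrix}\alpha,\ \gamma: & -\,; & \tfrac12\gamma+1\,;\\ 2\alpha+4+2i: & -\,; & \tfrac12\gamma\,;\end{matrix}\ -1,\ 1\right] =\frac{(-1)^i\,2^{i+2}}{(\alpha+2+i)\,(i+1)!}\sum_{r=0}^{i}(-1)^r\binom{i}{r}\frac{\Gamma\!\left(\frac{\alpha+i+r+3}{2}\right)}{\Gamma\!\left(\frac{\alpha-i+r+1}{2}\right)}$$ and $$F^{2:0;1}_{1:0;1}\left[\begin{matrix}\alpha,\ \gamma: & -\,; & \tfrac12\gamma+1\,;\\ 2\alpha+4-2i: & -\,; & \tfrac12\gamma\,;\end{matrix}\ -1,\ 1\right] =\frac{2^{2-i}}{\alpha+2-i}\sum_{r=0}^{i}\binom{i}{r}\frac{\Gamma\!\left(\frac{\alpha-i+r+3}{2}\right)}{\Gamma\!\left(\frac{\alpha-i+r+1}{2}\right)}.$$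
   Context: For $\lambda\in\mathbb{C}$ and $n\in\mathbb{N}_0$, $(\lambda)_0=1$ and $(\lambda)_n=\lambda(\lambda+1)\cdots(\lambda+n-1)$; $\Gamma$ is Euler's Gamma function and $\binom{i}{r}$ the binomial coefficient. The (generalized) Kampé de Fériet function is defined by $$F^{H:A;B}_{G:C;D}\left[\begin{matrix}(h_H): & (a_A)\,; & (b_B)\,;\\ (g_G): & (c_C)\,; & (d_D)\,;\end{matrix}\ x,\ y\right]=\sum_{m=0}^\infty\sum_{n=0}^\infty\frac{\prod_{j=1}^H(h_j)_{m+n}\prod_{j=1}^A(a_j)_m\prod_{j=1}^B(b_j)_n}{\prod_{j=1}^G(g_j)_{m+n}\prod_{j=1}^C(c_j)_m\prod_{j=1}^D(d_j)_n}\frac{x^m}{m!}\frac{y^n}{n!},$$ where a dash ''$-$'' denotes an empty list of parameters (empty products equal $1$). Parameters are tacitly assumed to be such that the double series converges, no denominator parameter is a non-positive integer, and all Gamma values appearing are finite. *)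

(* Defs.v *)
From HB Require Import structures.
From mathcomp Require Import all_boot all_order all_algebra.
From mathcomp Require Import all_classical all_reals all_analysis.
From mathcomp Require Import complex.
Set Implicit Arguments. Unset Strict Implicit. Unset Printing Implicit Defensive.
Import Order.TTheory GRing.Theory Num.Theory.
Import numFieldTopology.Exports numFieldNormedType.Exports.
Local Open Scope ring_scope.
Local Open Scope complex_scope.
Local Open Scope classical_set_scope.

(* the standard (norm-induced) topology of the numeric field R[i] = C,
   i.e. the library's generic instance for numClosedFieldType, on R[i] *)
#[export] HB.instance Definition _ (R : realType) :=
  PseudoPointedMetric.copy R[i] (R[i])^o.

Section KdF.
Variable R : realType.
Local Notation C := R[i].

Definition poch (x : C) (n : nat) : C := \prod_(k < n) (x + k%:R).

(* n^z = exp(z ln n) for a positive integer n and complex z *)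
Definition natcpow (n : nat) (z : C) : C :=
  let t := ln (n%:R : R) in
  (expR (complex.Re z * t))%:C *
  ((cos (complex.Im z * t))%:C + 'i * (sin (complex.Im z * t))%:C).

(* Euler's Gamma function on C, via the Euler--Gauss limit formula
   Gamma(z) = lim_{n -> oo} n^z n! / (z (z+1) ... (z+n)),
   valid for every z which is not a non-positive integer. *)
Definition Gamma (z : C) : C :=
  lim ((fun n : nat => natcpow n z * (n`!)%:R / \prod_(k < n.+1) (z + k%:R)) @ \oo).

Definition nonpos_int (z : C) : Prop := exists k : nat, z = - (k%:R).

Definition kdf_term (h a b g c d : seq C) (x y : C) (m n : nat) : C :=
  (\prod_(hj <- h) poch hj (m + n)) * (\prod_(aj <- a) poch aj m)
    * (\prod_(bj <- b) poch bj n)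
  / ((\prod_(gj <- g) poch gj (m + n)) * (\prod_(cj <- c) poch cj m)
    * (\prod_(dj <- d) poch dj n))
  * (x ^+ m / (m`!)%:R) * (y ^+ n / (n`!)%:R).

Definition kdf_partial (h a b g c d : seq C) (x y : C) (N : nat) : C :=
  \sum_(k < N.+1) \sum_(m < k.+1) kdf_term h a b g c d x y m (k - m).

Definition kdf_converges (h a b g c d : seq C) (x y : C) : Prop :=
  cvg (kdf_partial h a b g c d x y @ \oo).

Definition KdF (h a b g c d : seq C) (x y : C) : C :=
  lim (kdf_partial h a b g c d x y @ \oo).

End KdF.

(* Main.v *)
Require Import Defs.
From HB Require Import structures.
From mathcomp Require Import all_boot all_order all_algebra.
From mathcomp Require Import all_classical all_reals all_analysis.
From mathcomp Require Import complex.
From mathcomp Require Import ring lra.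
Import Order.TTheory GRing.Theory Num.Theory.
Import numFieldTopology.Exports numFieldNormedType.Exports.
Local Open Scope ring_scope.
Local Open Scope complex_scope.
Local Open Scope classical_set_scope.

(* Since (g+1)_n/(g)_n = (g+n)/g, the terms with m + n = k sum to a multiple of
   the alternating binomial sum of a polynomial of degree 1, which vanishes for
   k >= 2: the double series equals 1 + 2 alpha/c, with c the lower parameter.
   On the other side the Gamma quotients are Pochhammer symbols, and the two
   sums are an i-th difference of a polynomial of degree i+1 and the mean of an
   affine function.  Gamma(z+n)/Gamma(z) = (z)_n requires the Euler-Gauss limit
   to exist and to be nonzero: consecutive terms have ratio 1 + O(1/n^2), so the
   sequence and its inverse both converge as infinite products. *)

Set Implicit Arguments. Unset Strict Implicit.

(** * Taylor estimates for the real exponential, sine and cosine *)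

Section real_estimates.
Variable R : realType.
Implicit Types u v : R.

(** Mean value theorem between 0 and [v]. As [B] may depend on [v], linear bounds on a derivative
    turn into quadratic bounds on the function. *)
Lemma norm_sub0_le (f df : R -> R) (B v : R) :
  (forall x : R, is_derive x 1 f (df x)) ->
  (forall c, `|c| <= `|v| -> `|df c| <= B) ->
  `|f v - f 0| <= B * `|v|.
Proof.
move=> dfx dB.
have cf a b : {within `[a, b], continuous f}.
  apply: continuous_subspaceT => x; apply: differentiable_continuous.
  by apply/derivable1_diffP; case: (dfx x).
have [v0|v0|->] := ltgtP v 0; last by rewrite subrr !normr0 mulr0.
- have [c] := MVT v0 (fun x _ => dfx x) (cf v 0).
  rewrite in_itv/= => /andP[vc c0] e.
  rewrite distrC e normrM sub0r normrN ler_wpM2r//.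
  by apply: dB; rewrite !ltr0_norm// lerN2 ltW.
- have [c] := MVT v0 (fun x _ => dfx x) (cf 0 v).
  rewrite in_itv/= => /andP[c0 cv] e.
  rewrite e normrM subr0 ler_wpM2r//.
  by apply: dB; rewrite !gtr0_norm// ltW.
Qed.

Lemma norm_sin_le v : `|sin v| <= `|v|.
Proof.
have := @norm_sub0_le sin cos 1 v (fun x => is_derive_sin x).
by rewrite sin0 subr0 mul1r; apply => c _; exact: cos_max.
Qed.

Lemma norm_cos_sub1_le v : `|cos v - 1| <= `|v|.
Proof.
have := @norm_sub0_le cos (fun x => - sin x) 1 v (fun x => is_derive_cos x).
by rewrite cos0 mul1r; apply => c _; rewrite normrN sin_max.
Qed.

Lemma norm_cos_sub1_le_sqr v : `|cos v - 1| <= v ^+ 2.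
Proof.
have := @norm_sub0_le cos (fun x => - sin x) `|v| v (fun x => is_derive_cos x).
rewrite cos0 -expr2 real_normK ?num_real//; apply => c cv.
by rewrite normrN (le_trans (norm_sin_le c)).
Qed.

Lemma norm_sin_sub_le_sqr v : `|sin v - v| <= v ^+ 2.
Proof.
have := @norm_sub0_le (sin \- id) (fun x => cos x - 1) `|v| v.
rewrite /= sin0 !subr0 -expr2 real_normK ?num_real//; apply => c.
by move=> cv; rewrite (le_trans (norm_cos_sub1_le c)).
Qed.

(** From [expR (- u) >= 1 - u] follows [expR u <= 1 / (1 - u)], so the remainder is at most u^2 / (1
    - u), and 1 - u >= 1/2. *)
Lemma norm_expR_sub_le_sqr u : `|u| <= 2^-1 ->
  `|expR u - 1 - u| <= 2 * u ^+ 2.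
Proof.
rewrite ler_norml => /andP[u1 u2].
have h1 : 0 <= expR u - 1 - u by have := expR_ge1Dx u; lra.
rewrite ger0_norm//.
have h2 := expR_ge1Dx (- u).
have h3 : expR u * (1 - u) <= 1.
  by rewrite -[leRHS](expRxMexpNx_1 u) ler_wpM2l ?expR_ge0//.
have h4 : 0 <= u ^+ 2 * (1 - 2 * u) by rewrite mulr_ge0 ?sqr_ge0//; lra.
have u3 : 0 < 1 - u by lra.
suff : 0 <= (1 - u) * (2 * u ^+ 2 - (expR u - 1 - u)).
  by rewrite pmulr_rge0// subr_ge0.
have -> : (1 - u) * (2 * u ^+ 2 - (expR u - 1 - u)) =
   u ^+ 2 * (1 - 2 * u) + (1 - expR u * (1 - u)) by ring.
by rewrite addr_ge0// subr_ge0.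
Qed.

(** The two terms are the real and imaginary parts of exp(w) - 1 - w for w = u + iv. The pieces
    below add up to 9/2 u^2 + 7/2 v^2, rounded up to the constant 5. *)
Lemma expR_trig_taylor1 u v : `|u| <= 2^-1 ->
  `|expR u * cos v - 1 - u| + `|expR u * sin v - v| <= 5 * (u ^+ 2 + v ^+ 2).
Proof.
move=> u2; have hu : `|1 + u| <= 3 / 2.
  by rewrite (le_trans (ler_normD _ _))// normr1; lra.
have he := norm_expR_sub_le_sqr u2.
have -> : expR u * cos v - 1 - u =
  (expR u - 1 - u) * cos v + (1 + u) * (cos v - 1) by ring.
have -> : expR u * sin v - v =
  (expR u - 1 - u) * sin v + (1 + u) * (sin v - v) + u * v by ring.
have h1 : `|(expR u - 1 - u) * cos v| <= 2 * u ^+ 2 * 1.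
  by rewrite normrM ler_pM// cos_max.
have h2 : `|(expR u - 1 - u) * sin v| <= 2 * u ^+ 2 * 1.
  by rewrite normrM ler_pM// sin_max.
have h3 : `|(1 + u) * (cos v - 1)| <= 3 / 2 * v ^+ 2.
  by rewrite normrM ler_pM// norm_cos_sub1_le_sqr.
have h4 : `|(1 + u) * (sin v - v)| <= 3 / 2 * v ^+ 2.
  by rewrite normrM ler_pM// norm_sin_sub_le_sqr.
have h5 : `|u * v| <= (u ^+ 2 + v ^+ 2) / 2.
  rewrite ler_norml.
  by have := sqr_ge0 (u + v); have := sqr_ge0 (u - v); lra.
have h6 := ler_normD ((expR u - 1 - u) * cos v) ((1 + u) * (cos v - 1)).
have h7 := ler_normD ((expR u - 1 - u) * sin v) ((1 + u) * (sin v - v)).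
have h8 := ler_normD ((expR u - 1 - u) * sin v + (1 + u) * (sin v - v)) (u * v).
by have := sqr_ge0 u; have := sqr_ge0 v; lra.
Qed.

End real_estimates.

(** * Complex moduli, convergence and infinite products *)

Section complex_sequences.
Variable R : realType.
Local Notation C := R[i].
Implicit Types z w : C.

(** The norm of [R[i]] takes its values in [R[i]]; this real-valued copy gives access to squeezing
    and to real series. *)
Definition cmod (z : C) : R := ComplexField.Normc.normc z.

Lemma norm_cmod z : `|z| = (cmod z)%:C.
Proof. by []. Qed.

Lemma cmod0 : cmod 0 = 0.
Proof. exact: ComplexField.Normc.normc0. Qed.

Lemma cmod1 : cmod 1 = 1.
Proof. exact: ComplexField.Normc.normc1. Qed.

Lemma cmodM z w : cmod (z * w) = cmod z * cmod w.
Proof. exact: ComplexField.Normc.normcM. Qed.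

Lemma cmodV z : cmod z^-1 = (cmod z)^-1.
Proof. exact: ComplexField.Normc.normcV. Qed.

Lemma cmodN z : cmod (- z) = cmod z.
Proof. exact: normcN. Qed.

Lemma cmodD_le z w : cmod (z + w) <= cmod z + cmod w.
Proof. exact: le_normcD. Qed.

Lemma cmod_ge0 z : 0 <= cmod z.
Proof. by case: z => a b; exact: sqrtr_ge0. Qed.

Lemma cmod_le_ReIm z : cmod z <= `|complex.Re z| + `|complex.Im z|.
Proof.
case: z => a b /=; rewrite -[leRHS]ger0_norm ?addr_ge0// -sqrtr_sqr.
rewrite ler_wsqrtr// sqrrD !real_normK ?num_real// addrAC lerDl.
by rewrite mulrn_wge0// mulr_ge0.
Qed.

Lemma norm_Re_le z : `|complex.Re z| <= cmod z.
Proof. by rewrite -lecR; exact: normc_ge_Re. Qed.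

Lemma norm_Im_le z : `|complex.Im z| <= cmod z.
Proof. by case: z => a b /=; rewrite -sqrtr_sqr ler_wsqrtr// lerDr sqr_ge0. Qed.

Lemma cvg_cmod (f : nat -> C) (l : C) :
  (fun n => cmod (l - f n) : R) @ \oo --> (0 : R) -> f @ \oo --> l.
Proof.
move=> h; apply/(@cvgrPdist_lt C C^o) => e e0.
(* The radius of the ball is a complex number; being positive, it is real. *)
have /complex_realP [d de] : e \is Num.real by exact: gtr0_real.
rewrite {}de ltcR in e0 *.
move/cvgrPdist_lt: h => /(_ d e0); apply: filterS => n.
by rewrite norm_cmod sub0r normrN ltcR; apply: le_lt_trans; exact: ler_norm.
Qed.

Lemma complex_cvg_lim (f : nat -> C) (l : C) : f @ \oo --> l -> lim (f @ \oo) = l.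
Proof. by apply/cvg_lim; exact: (@norm_hausdorff C C^o). Qed.

Lemma complex_cvgM (f g : nat -> C) (a b : C) :
  f @ \oo --> a -> g @ \oo --> b -> (fun n => f n * g n) @ \oo --> a * b.
Proof. exact (@cvgM C nat \oo _ f g a b). Qed.

Lemma complex_cvg_ReIm (f : nat -> C) (a b : R) :
  (fun n => complex.Re (f n)) @ \oo --> a ->
  (fun n => complex.Im (f n)) @ \oo --> b -> f @ \oo --> (a +i* b : C).
Proof.
move=> fa fb; apply: cvg_cmod.
have h : (fun n => `|a - complex.Re (f n)| + `|b - complex.Im (f n)|) @ \oo
     --> (0 : R).
  rewrite -[0]addr0 -(normr0 R); apply: cvgD; apply: cvg_norm.
    by rewrite -(subrr a); apply: cvgB => //; exact: cvg_cst.
  by rewrite -(subrr b); apply: cvgB => //; exact: cvg_cst.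
apply: (squeeze_cvgr _ (cvg_cst 0) h); apply: nearW => n.
rewrite cmod_ge0/=; apply: le_trans (cmod_le_ReIm _) _.
by case: (f n).
Qed.

(** The increments of the real and imaginary parts are dominated by [r], so both telescoping series
    converge absolutely. *)
Lemma complex_cvg_telescope (p : nat -> C) (r : nat -> R) :
  (forall n, cmod (p n.+1 - p n) <= r n) -> cvgn (series r) ->
  exists l : C, p @ \oo --> l.
Proof.
move=> pr cr.
have key (x : nat -> R) : (forall n, `|x n.+1 - x n| <= r n) -> cvgn x.
  move=> xr.
  have : cvgn (series (telescope x)).
    apply: normed_cvg; apply: series_le_cvg cr => n //=.
    - exact: le_trans (xr n).
    - exact: xr.
  move=> h; rewrite (funext (eq_sum_telescope x)).
  by apply: is_cvgD => //; exact: is_cvg_cst.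
exists (limn (fun n => complex.Re (p n)) +i* limn (fun n => complex.Im (p n))).
apply: complex_cvg_ReIm; apply: key => n; apply: le_trans (pr n).
  by apply: le_trans (norm_Re_le _); case: (p n.+1) (p n) => [? ?] [? ?].
by apply: le_trans (norm_Im_le _); case: (p n.+1) (p n) => [? ?] [? ?].
Qed.

(** Since 1 + x <= exp x, the partial products stay below [M], the initial modulus times the
    exponential of the sum of [r]. The increments [p n * a n] are then dominated by the summable
    [M * r n]. *)
Lemma complex_cvg_prod (p a : nat -> C) (r : nat -> R) :
  (forall n, p n.+1 = p n * (1 + a n)) -> (forall n, cmod (a n) <= r n) ->
  cvgn (series r) -> exists l : C, p @ \oo --> l.
Proof.
move=> pS ar cr.
have r0 n : 0 <= r n := le_trans (cmod_ge0 _) (ar n).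
have pb n : cmod (p n) <= cmod (p 0%N) * expR (series r n).
  elim: n => [|n ih]; first by rewrite seriesEnat/= big_geq// expR0 mulr1.
  rewrite pS cmodM.
  have -> : series r n.+1 = series r n + r n.
    by rewrite -[in RHS](seriesSB r n) addrC subrK.
  rewrite expRD mulrA ler_pM ?cmod_ge0//.
  rewrite (le_trans (cmodD_le _ _))// cmod1.
  by rewrite (le_trans _ (expR_ge1Dx _))// lerD2l.
pose M := cmod (p 0%N) * expR (limn (series r)).
apply: (@complex_cvg_telescope p (fun n => M * r n)).
  move=> n; rewrite pS mulrDr mulr1 addrAC subrr add0r cmodM.
  rewrite ler_pM ?cmod_ge0// (le_trans (pb n))// ler_wpM2l ?cmod_ge0//.
  rewrite ler_expR; apply: nondecreasing_cvgn_le => //.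
  by apply/nondecreasing_seqP => k; rewrite -subr_ge0 seriesSB.
exact: is_cvg_seriesZ.
Qed.

End complex_sequences.

(** * The complex exponential along a real parameter *)

Section complex_exponential.
Variable R : realType.
Local Notation C := R[i].
Implicit Types z : C.

(* exp(z t) for real t, so that [natcpow n z] is [cexpM z (ln n%:R)] *)
Definition cexpM (z : C) (t : R) : C :=
  (expR (complex.Re z * t))%:C *
  ((cos (complex.Im z * t))%:C + 'i * (sin (complex.Im z * t))%:C).

Lemma cexpME z t : cexpM z t =
  (expR (complex.Re z * t) * cos (complex.Im z * t)) +i*
  (expR (complex.Re z * t) * sin (complex.Im z * t)).
Proof.
rewrite /cexpM; apply/eqP; rewrite eq_complex/=.
by apply/andP; split; apply/eqP; ring.
Qed.

Lemma cexpMD z s t : cexpM z (s + t) = cexpM z s * cexpM z t.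
Proof.
rewrite !cexpME !mulrDr expRD cosD sinD; apply/eqP.
by rewrite eq_complex/=; apply/andP; split; apply/eqP; ring.
Qed.

Lemma cexpM0 z : cexpM z 0 = 1.
Proof. by rewrite cexpME !mulr0 expR0 cos0 sin0 mulr0 mulr1. Qed.

Lemma cexpM_neq0 z t : cexpM z t != 0.
Proof.
apply/eqP => h; have := cexpMD z t (- t).
by rewrite subrr cexpM0 h mul0r => /eqP; rewrite oner_eq0.
Qed.

Lemma cmod_sqr z : cmod z ^+ 2 = complex.Re z ^+ 2 + complex.Im z ^+ 2.
Proof. by case: z => a b /=; rewrite sqr_sqrtr// addr_ge0 ?sqr_ge0. Qed.

Lemma cexpM_taylor1 z t : `|t| * cmod z <= 2^-1 ->
  cmod (cexpM z t - 1 - z * t%:C) <= 5 * (cmod z * t) ^+ 2.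
Proof.
move=> h; apply: le_trans (cmod_le_ReIm _) _.
rewrite exprMn cmod_sqr cexpME; have hr := norm_Re_le z.
have u2 : `|complex.Re z * t| <= 2^-1.
  by rewrite normrM mulrC (le_trans _ h)// ler_wpM2l.
have := expR_trig_taylor1 (complex.Im z * t) u2.
by rewrite !exprMn -mulrDl; case: (z) => x y /=;
  rewrite !(mulr0, subr0, addr0, add0r).
Qed.

End complex_exponential.

(** * The Euler-Gauss limit, its nonvanishing, and the recurrence of Gamma *)

Section gamma_limit.
Variable R : realType.
Local Notation C := R[i].
Implicit Types z : C.

Lemma cmod_real (x : R) : cmod x%:C = `|x|.
Proof. by rewrite /= expr0n/= addr0 sqrtr_sqr. Qed.

Lemma cmod_nat n : cmod (n%:R : C) = n%:R :> R.
Proof. by rewrite -(rmorph_nat (real_complex R)) cmod_real normr_nat. Qed.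

Lemma cmodB_ge z (w : C) : cmod w - cmod z <= cmod (z + w).
Proof.
rewrite lerBlDr -(cmodN z) (le_trans _ (cmodD_le _ _))//.
by rewrite addrAC subrr add0r.
Qed.

(** Both bounds are ln(1 + x) <= x: the upper one at x = 1/n, the lower one at x = -1/(n+1), because
    1 - 1/(n+1) is the inverse of 1 + 1/n. *)
Lemma ln_succ_sub_bounds n : (0 < n)%N ->
  n.+1%:R^-1 <= ln (n.+1%:R : R) - ln n%:R <= n%:R^-1.
Proof.
move=> n0; have n0R : 0 < n%:R :> R by rewrite ltr0n.
have -> : ln n.+1%:R - ln n%:R = ln (1 + n%:R^-1) :> R.
  rewrite -ln_div ?posrE ?ltr0n//; congr ln.
  by rewrite -natr1 mulrDl mul1r divff// gt_eqF.
apply/andP; split; last first.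
  by apply: le_ln1Dx; apply: lt_trans (_ : 0 < _); rewrite ?ltrN10 ?invr_gt0.
rewrite -lerN2 -lnV ?posrE ?addr_gt0 ?invr_gt0//.
have -> : (1 + n%:R^-1)^-1 = 1 + (- n.+1%:R^-1) :> R.
  rewrite -natr1; field.
  by rewrite !gt_eqF// ?addr_gt0.
apply: le_ln1Dx; rewrite ltrN2 invf_lt1 ?ltr0n// ltr1n ltnS//.
Qed.

(** The quotient ((n+1)/n)^z (n+1)/(z+n+1) of consecutive terms of the Euler-Gauss sequence. *)
Definition gauss_ratio z n : C :=
  cexpM z (ln n.+1%:R - ln n%:R) * n.+1%:R / (z + n.+1%:R).

Lemma cmod_nat_shift_ge z n : cmod z * 2 <= n%:R ->
  n.+1%:R / 2 <= cmod (z + n.+1%:R).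
Proof.
move=> zn; apply: le_trans (cmodB_ge _ _).
by rewrite cmod_nat -natr1; lra.
Qed.

Lemma gauss_ratio_sub1_le z n : (0 < n)%N -> cmod z * 2 <= n%:R ->
  cmod (gauss_ratio z n - 1) <=
  (20 * cmod z ^+ 2 + 2 * cmod z) / (n%:R * n.+1%:R).
Proof.
move=> n0 zn; have n0R : 0 < n%:R :> R by rewrite ltr0n.
have n1R : 1 <= n%:R :> R by rewrite ler1n.
have m0R : 0 < n.+1%:R :> R by rewrite ltr0n.
have dge := cmod_nat_shift_ge zn.
have dneq0 : z + n.+1%:R != 0.
  apply/eqP => d0; move: dge; rewrite d0 cmod0.
  by apply/negP; rewrite -ltNge divr_gt0.
have /andP[s1 s2] := ln_succ_sub_bounds n0.
rewrite /gauss_ratio; set s := ln _ - ln _ in s1 s2 *.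
have X0 := cmod_ge0 z; set X := cmod z in zn X0 *.
have s0 : 0 < s by apply: lt_le_trans s1; rewrite invr_gt0.
have Xs : `|s| * X <= 2^-1.
  rewrite gtr0_norm//.
  apply: (@le_trans _ _ (n%:R^-1 * X)); first by rewrite ler_wpM2r.
  by rewrite ler_pdivrMl//; lra.
have ht := cexpM_taylor1 Xs; set w := cexpM z s - 1 - z * s%:C in ht.
(* With m = n+1, expanding the exponential to first order leaves m w + z (m s - 1) in the numerator.
   Both terms are O(1/n), since s is close to 1/m and w is O(s^2); the denominator supplies the
   second factor 1/n. *)
have -> : cexpM z s * n.+1%:R / (z + n.+1%:R) - 1 =
   (n.+1%:R * w + z * (n.+1%:R * s - 1)%:C) / (z + n.+1%:R).
  have -> : (n.+1%:R * s - 1)%:C = n.+1%:R * s%:C - 1.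
    by rewrite rmorphB/= rmorphM/= rmorph_nat rmorph1.
  by rewrite /w; move: (n.+1%:R : C) dneq0 => m dneq0; field.
rewrite cmodM cmodV.
rewrite ler_pdivrMr; last by apply: lt_le_trans dge; rewrite divr_gt0.
apply: (le_trans (cmodD_le _ _)).
rewrite !cmodM cmod_nat cmod_real -/X.
have ms0 : 0 <= n.+1%:R * s - 1.
  by rewrite subr_ge0 -ler_pdivrMl// mulr1.
rewrite (ger0_norm ms0).
have ms : n.+1%:R * s - 1 <= n%:R^-1.
  rewrite lerBlDr (le_trans (ler_wpM2l (ltW m0R) s2))//.
  by rewrite -natr1 mulrDl mul1r divff ?gt_eqF// addrC.
have s2n : s ^+ 2 <= n%:R^-1 ^+ 2 by rewrite lerXn2r// ?nnegrE ltW// invr_gt0.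
have ms2 : n.+1%:R * s ^+ 2 <= 2 / n%:R.
  rewrite (le_trans (ler_wpM2l (ltW m0R) s2n))//.
  rewrite expr2 mulrA ler_wpM2r ?invr_ge0 ?(ltW n0R)//.
  by rewrite ler_pdivrMr// -natr1; lra.
apply: (@le_trans _ _ ((10 * X ^+ 2 + X) / n%:R)).
  rewrite mulrDl lerD//; last by rewrite ler_wpM2l.
  apply: le_trans (ler_wpM2l (ltW m0R) ht) _.
  have -> : n.+1%:R * (5 * (X * s) ^+ 2) = 5 * X ^+ 2 * (n.+1%:R * s ^+ 2).
    by ring.
  have -> : 10 * X ^+ 2 / n%:R = 5 * X ^+ 2 * (2 / n%:R).
    by ring.
  by rewrite ler_wpM2l// mulr_ge0// sqr_ge0.
(* The lower bound (n+1)/2 for the denominator doubles the constants 10 and 1 to 20 and 2. *)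
apply: (@le_trans _ _
  ((20 * X ^+ 2 + 2 * X) / (n%:R * n.+1%:R) * (n.+1%:R / 2))).
  rewrite le_eqVlt; apply/orP; left; apply/eqP; field.
  by rewrite !gt_eqF.
rewrite ler_wpM2l// divr_ge0//; first by rewrite addr_ge0 ?mulr_ge0 ?sqr_ge0.
Qed.

Lemma is_cvg_series_inv_consecutive (K : R) :
  cvgn (series (fun n => K / (n.+1%:R * n.+2%:R))).
Proof.
apply: is_cvg_seriesZ.
have -> : (fun n => (n.+1%:R * n.+2%:R)^-1) = telescope (fun n => - n.+1%:R^-1 : R).
  apply/funext => n; rewrite /telescope/= opprK -[n.+2%:R]natr1; field.
  by rewrite !gt_eqF// ?addr_gt0// ltr0n.
rewrite telescopeK; apply: is_cvgB; last exact: is_cvg_cst.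
apply: is_cvgN; apply: cvgP; exact: cvg_harmonic.
Qed.

Lemma complex_cvg_shift (p : nat -> C) (l : C) N :
  (fun n => p (n + N)%N) @ \oo --> l <-> p @ \oo --> l.
Proof. by rewrite -(cvg_shiftn N p (nbhs l)). Qed.

(** The product criterion is applied to the sequence shifted by [N]. As [N >= 1], the bound at index
    n + N is at most K/((n+1)(n+2)), a telescoping series. *)
Lemma complex_cvg_prod_near (p a : nat -> C) (K : R) (N : nat) : (0 < N)%N ->
  (forall n, p n.+1 = p n * (1 + a n)) ->
  (forall n, (N <= n)%N -> cmod (a n) <= K / (n%:R * n.+1%:R)) ->
  exists l : C, p @ \oo --> l.
Proof.
move=> N0 pS aK.
have K0 : 0 <= K.
  have /(le_trans (cmod_ge0 _)) := aK N (leqnn N).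
  by rewrite ler_pdivlMr ?mul0r// mulr_gt0 ?ltr0n.
have [n|||l pl] := @complex_cvg_prod R (fun n => p (n + N)%N)
    (fun n => a (n + N)%N) (fun n => K / (n.+1%:R * n.+2%:R)).
- exact: pS.
- move=> n; apply: le_trans (aK _ (leq_addl _ _)) _.
  rewrite ler_wpM2l// lef_pV2 ?posrE ?mulr_gt0 ?ltr0n ?addn_gt0 ?N0 ?orbT//.
  have nN : (n < n + N)%N by rewrite -[X in (X < _)%N]addn0 ltn_add2l.
  by rewrite ler_pM// ler_nat ?ltnS.
- exact: is_cvg_series_inv_consecutive.
by exists l; apply/(complex_cvg_shift _ _ N).
Qed.

Definition gauss_seq z n : C :=
  natcpow n z * (n`!)%:R / \prod_(k < n.+1) (z + k%:R).

(** Through a difference of logarithms the identity also covers n = 0, whatever value [ln] takes at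
    0. *)
Lemma gauss_seqS z n : gauss_seq z n.+1 = gauss_seq z n * gauss_ratio z n.
Proof.
rewrite /gauss_seq /gauss_ratio big_ord_recr/= factS natrM invfM.
have -> : natcpow n.+1 z = natcpow n z * cexpM z (ln n.+1%:R - ln n%:R).
  by rewrite -[natcpow n z]/(cexpM z (ln n%:R)) -cexpMD addrC subrK.
by ring.
Qed.

Lemma not_nonpos_int_neq0 z k : ~ nonpos_int z -> z + k%:R != 0.
Proof. by move=> hz; apply/eqP => /eqP; rewrite addr_eq0 => /eqP zk; apply: hz; exists k. Qed.

Lemma gauss_seq_neq0 z n : ~ nonpos_int z -> gauss_seq z n != 0.
Proof.
move=> hz; rewrite /gauss_seq -[natcpow n z]/(cexpM z (ln n%:R)).
apply: mulf_neq0; first apply: mulf_neq0.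
- exact: cexpM_neq0.
- by rewrite pnatr_eq0 -lt0n fact_gt0.
by apply: invr_neq0; apply/prodf_neq0 => k _; exact: not_nonpos_int_neq0.
Qed.

(** The sequence and its inverse both meet the product criterion; their limits multiply to 1, so
    neither is zero. *)
Lemma gauss_seq_cvg z : ~ nonpos_int z ->
  exists2 l : C, gauss_seq z @ \oo --> l & l != 0.
Proof.
move=> hz; set X := cmod z; have X0 : 0 <= X := cmod_ge0 z.
pose K := 20 * X ^+ 2 + 2 * X.
have K0 : 0 <= K by rewrite addr_ge0 ?mulr_ge0 ?sqr_ge0.
(* Beyond [N], n >= 2X gives the estimate on the ratio, and n >= 2K makes its distance to 1 at most
   1/2. *)
pose N := (Num.truncn (2 * X + 2 * K)).+1.
have XN n : (N <= n)%N -> 2 * X + 2 * K <= n%:R.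
  move=> Nn; apply: ltW; apply: lt_le_trans (_ : N%:R <= _); last by rewrite ler_nat.
  exact: truncnS_gt.
have aK n : (N <= n)%N -> cmod (gauss_ratio z n - 1) <= K / (n%:R * n.+1%:R).
  move=> Nn; apply: gauss_ratio_sub1_le; first exact: leq_trans Nn.
  by have := XN n Nn; rewrite -/X; lra.
have [l hl] : exists l : C, gauss_seq z @ \oo --> l.
  apply: (@complex_cvg_prod_near _ (fun n => gauss_ratio z n - 1) K N) => // n.
  by rewrite addrC subrK gauss_seqS.
have rn0 n : gauss_ratio z n != 0.
  apply/eqP => r0; have := gauss_seq_neq0 n.+1 hz.
  by rewrite gauss_seqS r0 mulr0 eqxx.
have [l' hl'] : exists l' : C, (fun n => (gauss_seq z n)^-1) @ \oo --> l'.
  apply: (@complex_cvg_prod_near _ (fun n => (gauss_ratio z n)^-1 - 1) (2 * K) N) => // n.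
    by rewrite addrC subrK gauss_seqS invfM.
  move=> Nn; have h := aK n Nn.
  have n0 : (0 < n)%N := leq_trans (ltn0Sn _) Nn.
  have h2 : K / (n%:R * n.+1%:R) <= 2^-1.
    rewrite ler_pdivrMr ?mulr_gt0 ?ltr0n//.
    have n2 : 0 <= n%:R * n%:R :> R by rewrite mulr_ge0.
    by have := XN n Nn; rewrite -[n.+1%:R]natr1; lra.
  have h3 : 2^-1 <= cmod (gauss_ratio z n).
    have := cmodB_ge (gauss_ratio z n - 1) 1.
    have := le_trans h h2; rewrite subrK cmod1.
    by move: (cmod _) (cmod _) => x y; lra.
  (* The ratio has modulus at least 1/2, so inverting it costs a factor 2; hence the constant
     [2 * K]. *)
  have -> : (gauss_ratio z n)^-1 - 1 = - (gauss_ratio z n - 1) / gauss_ratio z n.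
    by rewrite opprB mulrBl mul1r divff.
  rewrite cmodM cmodN cmodV.
  rewrite ler_pdivrMr; last by apply: lt_le_trans h3; rewrite invr_gt0.
  apply: le_trans h _.
  have k0 : 0 <= K / (n%:R * n.+1%:R) by rewrite divr_ge0 ?mulr_ge0.
  rewrite [leRHS](_ : _ = K / (n%:R * n.+1%:R) * (2 * cmod (gauss_ratio z n))).
    by rewrite ler_peMr//; lra.
  by ring.
exists l => //; apply/eqP => l0.
have : (fun n => gauss_seq z n * (gauss_seq z n)^-1) @ \oo --> l * l'.
  exact: complex_cvgM.
have -> : (fun n => gauss_seq z n * (gauss_seq z n)^-1) = (fun=> 1).
  by apply/funext => n; rewrite divff// gauss_seq_neq0.
move=> /complex_cvg_lim; rewrite l0 mul0r.
rewrite (@complex_cvg_lim _ _ 1); last exact: cvg_cst.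
by move/eqP; rewrite oner_eq0.
Qed.

Lemma Gamma_neq0 z : ~ nonpos_int z -> Gamma z != 0.
Proof. by move=> /gauss_seq_cvg[l /complex_cvg_lim <-]. Qed.

Lemma natcpowD1 z n : (0 < n)%N -> natcpow n (z + 1) = natcpow n z * n%:R.
Proof.
move=> n0; rewrite /natcpow; have -> : complex.Im (z + 1) = complex.Im z.
  by case: z => x y /=; rewrite addr0.
have -> : complex.Re (z + 1) = complex.Re z + 1 by case: z => x y.
rewrite mulrDl mul1r expRD lnK ?posrE ?ltr0n// rmorphM/= rmorph_nat.
by rewrite mulrAC.
Qed.

(** The denominator product for z + 1 is the one for z without its first factor z and with one more
    factor z+n+2; the power contributes n+1. *)
Lemma gauss_seqD1 z n : ~ nonpos_int z ->
  gauss_seq (z + 1) n.+1 = z * (gauss_seq z n.+1 * (n.+1%:R / (z + n.+2%:R))).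
Proof.
move=> hz; rewrite /gauss_seq natcpowD1//.
rewrite big_ord_recr/= [in RHS]big_ord_recl/= addr0.
have -> : \prod_(k < n.+1) (z + (bump 0 k)%:R) = \prod_(k < n.+1) (z + 1 + k%:R).
  by apply: eq_bigr => k _; rewrite /bump add1n -[k.+1%:R]natr1 -addrA [1 + _]addrC.
have -> : z + 1 + n.+1%:R = z + n.+2%:R by rewrite -[n.+2%:R]natr1 -addrA [1 + _]addrC.
have z0 : z != 0 by have := not_nonpos_int_neq0 0 hz; rewrite addr0.
by rewrite !invfM; move: (_^-1) (_^-1) => a b; field.
Qed.

(** Limit of the preceding identity: the correction n/(z+n+1) differs from 1 by (z+1)/(z+n+1), which
    tends to 0. *)
Lemma GammaD1 z : ~ nonpos_int z -> Gamma (z + 1) = z * Gamma z.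
Proof.
move=> hz; have [l hl _] := gauss_seq_cvg hz.
have -> : Gamma z = l := complex_cvg_lim hl.
have hr : (fun n => n%:R / (z + n.+1%:R)) @ \oo --> (1 : C).
  apply: cvg_cmod.
  pose B := 2 * cmod (z + 1).
  have h : (fun n => B * n.+1%:R^-1) @ \oo --> (0 : R).
    by rewrite -(mulr0 B); apply: cvgM; [exact: cvg_cst|exact: cvg_harmonic].
  apply: (squeeze_cvgr _ (cvg_cst 0) h).
  exists (Num.truncn (cmod z * 2)).+1 => // n /= Nn; rewrite cmod_ge0/=.
  have zn : cmod z * 2 <= n%:R.
    apply: ltW; apply: lt_le_trans (truncnS_gt _) _; by rewrite ler_nat.
  have dneq0 := not_nonpos_int_neq0 n.+1 hz.
  have -> : 1 - n%:R / (z + n.+1%:R) = (z + 1) / (z + n.+1%:R).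
    rewrite -natr1 addrA addrAC in dneq0 *.
    by move: (n%:R : C) dneq0 => m dneq0; field.
  have h1 := cmod_nat_shift_ge zn.
  rewrite cmodM cmodV /B.
  rewrite [2 * _]mulrC -mulrA ler_wpM2l ?cmod_ge0//.
  have -> : 2 / n.+1%:R = (n.+1%:R / 2)^-1 :> R by rewrite invfM invrK mulrC.
  have p0 : 0 < n.+1%:R / 2 :> R by rewrite divr_gt0 ?ltr0n.
  by rewrite lef_pV2 ?posrE// (lt_le_trans p0).
apply: complex_cvg_lim.
have h : (fun n => z * (gauss_seq z n * (n%:R / (z + n.+1%:R)))) @ \oo --> z * l.
  by rewrite -[l in z * l]mulr1; apply: complex_cvgM; [exact: cvg_cst|exact: complex_cvgM].
(* The finite identity holds at positive indices, hence the shift by one. *)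
apply/(complex_cvg_shift (gauss_seq (z + 1)) _ 1).
have -> : (fun n => gauss_seq (z + 1) (n + 1)) =
  (fun n => z * (gauss_seq z (n + 1) * ((n + 1)%:R / (z + (n + 1).+1%:R)))).
  by apply/funext => n; rewrite addn1 gauss_seqD1.
by move: h => /(proj2 (complex_cvg_shift _ _ 1)).
Qed.

Lemma Gamma_addn z n : ~ nonpos_int z -> Gamma (z + n%:R) = poch z n * Gamma z.
Proof.
elim: n => [|n ih] hz; first by rewrite addr0 /poch big_ord0 mul1r.
rewrite -natr1 addrA GammaD1; last first.
  by move=> [k zk]; apply: hz; exists (k + n)%N; rewrite natrD opprD -zk addrK.
by rewrite ih// /poch big_ord_recr/= mulrAC mulrC.
Qed.

Lemma Gamma_ratio z n : ~ nonpos_int z -> Gamma (z + n%:R) / Gamma z = poch z n.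
Proof. by move=> hz; rewrite Gamma_addn// mulfK ?Gamma_neq0. Qed.

End gamma_limit.

(** * Alternating binomial sums as finite differences *)

Section alternating_binomial_sums.
Variable F : numFieldType.
Implicit Types (f : nat -> F) (c : F) (s : seq F).

(** Equal to (-1)^i times the i-th forward difference of [f] at 0. *)
Definition alt_binom_sum i f : F :=
  \sum_(r < i.+1) (-1) ^+ r * 'C(i, r)%:R * f r.

Lemma eq_alt_binom_sum i f g : f =1 g -> alt_binom_sum i f = alt_binom_sum i g.
Proof. by move=> fg; apply: eq_bigr => r _; rewrite fg. Qed.

Lemma alt_binom_sumD i f g :
  alt_binom_sum i (fun r => f r + g r) = alt_binom_sum i f + alt_binom_sum i g.
Proof. by rewrite -big_split/=; apply: eq_bigr => r _; rewrite mulrDr. Qed.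

Lemma alt_binom_sumZ i c f :
  alt_binom_sum i (fun r => c * f r) = c * alt_binom_sum i f.
Proof. by rewrite mulr_sumr; apply: eq_bigr => r _; rewrite mulrCA. Qed.

(** The absorption identity r C(i+1, r) = (i+1) C(i, r-1) lowers the order by one and shifts [f]. *)
Lemma alt_binom_sumM i f :
  alt_binom_sum i.+1 (fun r => r%:R * f r) =
  - (i.+1%:R * alt_binom_sum i (fun r => f r.+1)).
Proof.
rewrite /alt_binom_sum big_ord_recl/= mul0r mulr0 add0r mulr_sumr -sumrN.
apply: eq_bigr => r _; rewrite /bump/= add1n exprS.
have e : i.+1%:R * 'C(i, r)%:R = r.+1%:R * 'C(i.+1, r.+1)%:R :> F.
  by rewrite -!natrM -mul_bin_diag.
transitivity (- (-1) ^+ r * (r.+1%:R * 'C(i.+1, r.+1)%:R) * f r.+1); first by ring.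
by rewrite -e; ring.
Qed.

(** A monic polynomial in r, encoded by its negated roots: shifting r becomes a map on the list, and
    lowering the degree removes an entry. *)
Definition shifted_prod s (r : nat) : F := \prod_(c <- s) (r%:R + c).

Lemma shifted_prod_succ s r :
  shifted_prod s r.+1 = shifted_prod [seq c + 1 | c <- s] r.
Proof.
rewrite /shifted_prod big_map; apply: eq_bigr => c _.
by rewrite -[r.+1%:R]natr1 -addrA [1 + c]addrC.
Qed.

Lemma alt_binom_sum_cons i c s :
  alt_binom_sum i.+1 (shifted_prod (c :: s)) =
  - (i.+1%:R * alt_binom_sum i (shifted_prod [seq d + 1 | d <- s])) +
  c * alt_binom_sum i.+1 (shifted_prod s).
Proof.
rewrite -(eq_alt_binom_sum i (shifted_prod_succ s)) -alt_binom_sumM.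
rewrite -alt_binom_sumZ -alt_binom_sumD; apply: eq_alt_binom_sum => r.
by rewrite /shifted_prod big_cons mulrDl.
Qed.

Lemma alt_binom_sum_nil i : (0 < i)%N ->
  alt_binom_sum i (shifted_prod [::]) = 0.
Proof.
move=> i0; transitivity ((1 - 1 : F) ^+ i).
  rewrite exprDn; apply: eq_bigr => r _.
  by rewrite /shifted_prod big_nil mulr1 expr1n mul1r mulr_natr.
by rewrite subrr expr0n eqn0Ngt i0.
Qed.

Lemma alt_binom_sum_lt i s : (size s < i)%N ->
  alt_binom_sum i (shifted_prod s) = 0.
Proof.
(* Induction on a bound for the length, because the recursion also visits the tail with its entries
   shifted. *)
move: {2}(size s) (leqnn (size s)) i => n.
elim: n s => [|n ih] [|c s]//= => [_ i|_ i|]; try exact: alt_binom_sum_nil.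
rewrite ltnS => sn [|i]//; rewrite ltnS => si; rewrite alt_binom_sum_cons.
by rewrite !ih ?size_map// ?(ltnW si)// ?mulr0 ?oppr0 ?addr0// ltnW.
Qed.

(** When order and degree agree, only the leading coefficient 1 survives. *)
Lemma alt_binom_sum_eq s :
  alt_binom_sum (size s) (shifted_prod s) = (-1) ^+ size s * (size s)`!%:R.
Proof.
move: {-2}(size s) (erefl (size s)) => n; elim: n s => [|n ih] [|c s]//=.
  by rewrite /alt_binom_sum big_ord1 /shifted_prod big_nil !mulr1.
case=> sn; rewrite alt_binom_sum_cons ih ?size_map//.
by rewrite (alt_binom_sum_lt (s := s)) ?sn// factS natrM exprS; ring.
Qed.

(** With the degree one above the order, the two top coefficients count: 1, whose power r^(i+1) has
    i-th difference i! i(i+1)/2 at 0, and the sum of [s]. *)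
Lemma alt_binom_sum_succ i s : size s = i.+1 ->
  alt_binom_sum i (shifted_prod s) =
  (-1) ^+ i * i`!%:R * (i.+1%:R * i%:R / 2 + \sum_(c <- s) c).
Proof.
elim: i s => [|i ih] [|c s]//= [] si.
  case: s si => // _; rewrite /alt_binom_sum big_ord1 /shifted_prod !big_seq1.
  by rewrite bin0 fact0 mulr0 mul0r !expr0 !mul1r.
have es : alt_binom_sum i.+1 (shifted_prod s) = (-1) ^+ i.+1 * i.+1`!%:R.
  by rewrite -si alt_binom_sum_eq.
rewrite alt_binom_sum_cons ih ?size_map// es.
rewrite big_map big_split/= big_const_seq count_predT iter_addr_0 si.
rewrite big_cons factS natrM exprS -[i.+2%:R]natr1 -[i.+1%:R]natr1.
by field.
Qed.

(** Adding the sum to its reversal r -> i - r makes every affine factor equal to 2c + i. *)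
Lemma sum_binomial_affine i c :
  \sum_(r < i.+1) 'C(i, r)%:R * (c + r%:R) = 2 ^+ i * (c + i%:R / 2).
Proof.
set S := \sum_(r < _) _.
have e : S = \sum_(r < i.+1) 'C(i, r)%:R * (c + i%:R - r%:R).
  rewrite /S (reindex_inj rev_ord_inj)/=; apply: eq_bigr => r _.
  have ri : (r <= i)%N by rewrite -ltnS.
  by rewrite subSS bin_sub// natrB// addrA.
have e2 : S + S = 2 ^+ i * (2 * c + i%:R).
  have -> : 2 ^+ i = \sum_(r < i.+1) 'C(i, r)%:R :> F.
    rewrite -[2]/(1 + 1) exprDn; apply: eq_bigr => r _.
    by rewrite !expr1n mulr1.
  rewrite {2}e /S -big_split/= mulr_suml.
  by apply: eq_bigr => r _; ring.
by apply: (@mulfI _ 2) => //; rewrite mulr_natl mulr2n e2; field.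
Qed.

Lemma sum_arith_step2 n c :
  \sum_(k < n) (c + 2 * k%:R) = n%:R * (c + n%:R - 1).
Proof.
elim: n => [|n ih]; first by rewrite big_ord0 mul0r.
by rewrite big_ord_recr/= ih -[n.+1%:R]natr1; ring.
Qed.

End alternating_binomial_sums.

(** * Summation of the double series along antidiagonals *)

Section kampe_de_feriet.
Variable R : realType.
Local Notation C := R[i].
Implicit Types alpha gamma g c : C.

Lemma poch_neq0 g n : ~ nonpos_int g -> poch g n != 0.
Proof. by move=> hg; apply/prodf_neq0 => k _; exact: not_nonpos_int_neq0. Qed.

Lemma poch_add1 g n : poch (g + 1) n * g = poch g n * (g + n%:R).
Proof.
elim: n => [|n ih]; first by rewrite /poch !big_ord0 addr0.
rewrite /poch !big_ord_recr/= -!/(poch _ _) mulrAC ih.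
by rewrite -[n.+1%:R]natr1; ring.
Qed.

(** With n = k - m, the quotient (g+1)_n/(g)_n is (g+k-m)/g, so the dependence on m is linear; the
    factorials supply C(k, m)/k!. The leading minus sign makes the linear factor monic in m. *)
Lemma kdf_antidiagonal alpha gamma c k : ~ nonpos_int (gamma / 2) ->
  \sum_(m < k.+1) kdf_term [:: alpha; gamma] [::] [:: gamma / 2 + 1]
     [:: c] [::] [:: gamma / 2] (-1) 1 m (k - m) =
  - (poch alpha k * poch gamma k / poch c k / (gamma / 2) / k`!%:R) *
  alt_binom_sum k (shifted_prod [:: - (gamma / 2 + k%:R)]).
Proof.
set g := gamma / 2; clearbody g => hg; rewrite mulr_sumr; apply: eq_bigr => m _.
have mk : (m <= k)%N by rewrite -ltnS.
have g0 : g != 0 by have := not_nonpos_int_neq0 0 hg; rewrite addr0.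
have pg0 := poch_neq0 (k - m) hg.
rewrite /kdf_term /shifted_prod !big_cons !big_nil !mulr1 subnKC//.
have -> : poch (g + 1) (k - m) = poch g (k - m) * (g + k%:R - m%:R) / g.
  by rewrite -addrA -natrB// -poch_add1 mulfK.
have -> : k`!%:R = 'C(k, m)%:R * (m`!%:R * (k - m)`!%:R) :> C.
  by rewrite -!natrM bin_fact.
have b0 : 'C(k, m)%:R != 0 :> C by rewrite pnatr_eq0 -lt0n bin_gt0.
rewrite expr1n !invfM; move: (poch c k)^-1 (m`!%:R^-1) ((k - m)`!%:R^-1) => x y z.
by move: ('C(k, m)%:R : C) b0 => b b0; field; rewrite ?g0 ?b0 ?pg0.
Qed.

Lemma KdF_eval alpha gamma c : ~ nonpos_int (gamma / 2) ->
  KdF [:: alpha; gamma] [::] [:: gamma / 2 + 1] [:: c] [::] [:: gamma / 2] (-1) 1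
  = 1 + 2 * alpha / c.
Proof.
move=> hg; have g0 : gamma / 2 != 0.
  by have := not_nonpos_int_neq0 0 hg; rewrite addr0.
have y0 : gamma != 0 by apply: contraNneq g0 => ->; rewrite mul0r.
(* The partial sums are constant only from index 1 on: the one at index 0 consists of the term 1
   alone. *)
apply: complex_cvg_lim; apply/(complex_cvg_shift _ _ 1).
rewrite (_ : (fun n => _) = fun=> 1 + 2 * alpha / c); first exact: cvg_cst.
apply/funext => n; rewrite addn1 /kdf_partial.
under eq_bigr do rewrite kdf_antidiagonal//.
(* Antidiagonals k >= 2 vanish, being differences of order k of a polynomial of degree 1. *)
rewrite 2!big_ord_recl big1 => [|k _]; last first.
  by rewrite alt_binom_sum_lt ?mulr0.
rewrite /alt_binom_sum /= !big_ord_recl !big_ord0 /shifted_prod !big_seq1 /bump/=.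
rewrite /poch !big_ord_recl !big_ord0 /=.
rewrite /bump/= !addn0 !bin0 !binn factS fact0 muln1 !(addr0, mulr1, subr0).
by rewrite invr1; move: (c^-1) => x; field.
Qed.

End kampe_de_feriet.

(** * Evaluation of the two Gamma sums *)

Unset Implicit Arguments. Set Strict Implicit.

Theorem theorem13 (R : realType) (i : nat) (alpha gamma : R[i]) :
  (* first identity: lower parameter 2 alpha + 4 + 2 i *)
  (~ nonpos_int (2 * alpha + 4 + 2 * i%:R) ->
   ~ nonpos_int (gamma / 2) ->
   kdf_converges [:: alpha; gamma] [::] [:: gamma / 2 + 1]
                 [:: 2 * alpha + 4 + 2 * i%:R] [::] [:: gamma / 2] (-1) 1 ->
   (forall r : nat, (r <= i)%N ->
      ~ nonpos_int ((alpha + i%:R + r%:R + 3) / 2) /\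
      ~ nonpos_int ((alpha - i%:R + r%:R + 1) / 2)) ->
   KdF [:: alpha; gamma] [::] [:: gamma / 2 + 1]
       [:: 2 * alpha + 4 + 2 * i%:R] [::] [:: gamma / 2] (-1) 1
   = (-1) ^+ i * 2 ^+ (i + 2) / ((alpha + 2 + i%:R) * (i.+1)`!%:R)
     * \sum_(r < i.+1) (-1) ^+ r * 'C(i, r)%:R
         * (Gamma ((alpha + i%:R + r%:R + 3) / 2)
            / Gamma ((alpha - i%:R + r%:R + 1) / 2)))
  /\
  (* second identity: lower parameter 2 alpha + 4 - 2 i *)
  (~ nonpos_int (2 * alpha + 4 - 2 * i%:R) ->
   ~ nonpos_int (gamma / 2) ->
   kdf_converges [:: alpha; gamma] [::] [:: gamma / 2 + 1]
                 [:: 2 * alpha + 4 - 2 * i%:R] [::] [:: gamma / 2] (-1) 1 ->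
   (forall r : nat, (r <= i)%N ->
      ~ nonpos_int ((alpha - i%:R + r%:R + 3) / 2) /\
      ~ nonpos_int ((alpha - i%:R + r%:R + 1) / 2)) ->
   KdF [:: alpha; gamma] [::] [:: gamma / 2 + 1]
       [:: 2 * alpha + 4 - 2 * i%:R] [::] [:: gamma / 2] (-1) 1
   = 2 ^- i * 2 ^+ 2 / (alpha + 2 - i%:R)
     * \sum_(r < i.+1) 'C(i, r)%:R
         * (Gamma ((alpha - i%:R + r%:R + 3) / 2)
            / Gamma ((alpha - i%:R + r%:R + 1) / 2))).
Proof.
split=> hc hg _ hG; rewrite KdF_eval//.
(* With lower parameter 2d, the series equals (d + alpha)/d; the right-hand side has to reduce to
   the same fraction. *)
- pose d := alpha + 2 + i%:R.
  have cd : 2 * alpha + 4 + 2 * i%:R = 2 * d by rewrite /d; ring.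
  have d0 : d != 0.
    by have := not_nonpos_int_neq0 0 hc; rewrite addr0 cd mulf_eq0 negb_or => /andP[].
  (* The Gamma arguments differ by i+1, so their quotient is a Pochhammer symbol with i+1 factors.
     Doubling each factor gives r + (alpha - i + 1 + 2k), whence the list [s] and the power
     2^(i+1). *)
  pose s := [seq alpha - i%:R + 1 + 2 * k%:R | k <- iota 0 i.+1].
  have -> : \sum_(r < i.+1) (-1) ^+ r * 'C(i, r)%:R
         * (Gamma ((alpha + i%:R + r%:R + 3) / 2)
            / Gamma ((alpha - i%:R + r%:R + 1) / 2)) =
      alt_binom_sum i (fun r => 2 ^- i.+1 * shifted_prod s r).
    apply: eq_bigr => r _; congr (_ * _).
    have [_ hz] := hG r (ltn_ord r).
    have -> : (alpha + i%:R + r%:R + 3) / 2 =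
        (alpha - i%:R + r%:R + 1) / 2 + i.+1%:R.
      by rewrite -[i.+1%:R]natr1; field.
    rewrite Gamma_ratio// /poch /shifted_prod /s big_map -[iota 0 i.+1]/(index_iota 0 i.+1).
    rewrite big_mkord -[LHS](mulKf (x := 2 ^+ i.+1)); last by rewrite expf_neq0.
    congr (_ * _); rewrite -[X in 2 ^+ X](card_ord i.+1) -prodr_const -big_split/=.
    by apply: eq_bigr => k _; field.
  rewrite alt_binom_sumZ alt_binom_sum_succ ?size_map ?size_iota//.
  have -> : \sum_(c <- s) c = i.+1%:R * (alpha + 1).
    rewrite /s big_map -[iota 0 i.+1]/(index_iota 0 i.+1) big_mkord.
    by rewrite sum_arith_step2 -[i.+1%:R]natr1; ring.
  rewrite -/d cd factS natrM addn2 !exprS.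
  have i0 : i`!%:R != 0 :> R[i] by rewrite pnatr_eq0 -lt0n fact_gt0.
  have i1 : i.+1%:R != 0 :> R[i] by rewrite pnatr_eq0.
  have p0 : 2 ^+ i != 0 :> R[i] by rewrite expf_neq0.
  have sq : (-1) ^+ i * (-1) ^+ i = 1 :> R[i] by rewrite -exprMn mulrNN mulr1 expr1n.
  (* The sign of the prefactor meets the sign of the i-th difference; the powers of 2 and the
     factorials cancel. *)
  transitivity ((-1) ^+ i * (-1) ^+ i * ((2 * alpha + 2 + i%:R) / d)).
    rewrite sq mul1r; have -> : 2 * alpha + 2 + i%:R = d + alpha by rewrite /d; ring.
    by clearbody d; field.
  move: ((-1) ^+ i) (2 ^+ i) p0 (i`!%:R) i0 => x p p0 f f0.
  move: d0 i1; rewrite /d -[i.+1%:R]natr1 => d0 i1.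
  by field; rewrite p0 f0 i1 d0.
- pose d := alpha + 2 - i%:R.
  have cd : 2 * alpha + 4 - 2 * i%:R = 2 * d by rewrite /d; ring.
  have d0 : d != 0.
    by have := not_nonpos_int_neq0 0 hc; rewrite addr0 cd mulf_eq0 negb_or => /andP[].
  have -> : \sum_(r < i.+1) 'C(i, r)%:R * (Gamma ((alpha - i%:R + r%:R + 3) / 2)
            / Gamma ((alpha - i%:R + r%:R + 1) / 2)) =
      2^-1 * \sum_(r < i.+1) 'C(i, r)%:R * (alpha - i%:R + 1 + r%:R).
    rewrite mulr_sumr; apply: eq_bigr => r _.
    have [_ hz] := hG r (ltn_ord r).
    (* Here the arguments differ by 1, so the quotient is the lower argument itself, half of an
       affine function of r. *)
    have -> : (alpha - i%:R + r%:R + 3) / 2 =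
        (alpha - i%:R + r%:R + 1) / 2 + 1%:R by field.
    by rewrite Gamma_ratio// /poch big_ord1 addr0; field.
  rewrite sum_binomial_affine -/d cd.
  have p0 : 2 ^+ i != 0 :> R[i] by rewrite expf_neq0.
  move: (2 ^+ i) p0 d0 => p p0; rewrite /d => d0.
  by field; rewrite p0 d0.
Qed.
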